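(* Let $N_\alpha$ and $N_\beta$ be two regular timelike ruled surfaces of the same type in $E_1^3$, parametrized by $\vec r_\alpha(s_\alpha,v_\alpha)=\vec\alpha(s_\alpha)+v_\alpha\vec q_\alpha(s_\alpha)$ and $\vec r_\beta(s_\beta,v_\beta)=\vec\beta(s_\beta)+v_\beta\vec q_\beta(s_\beta)$, where $\vec\alpha,\vec\beta$ are the striction curves with arc length parameters $s_\alpha,s_\beta$. Suppose that $N_\alpha$ and $N_\beta$ are developable and that their striction curves have the same Lorentzian causal characters as the respective rulings. Then $N_\alpha$ and $N_\beta$ are timelike similar ruled surfaces with variable transformation if and only if the striction curves $\vec\alpha$ and $\vec\beta$ are similar curves with variable transformation.
   Context: $E_1^3$ is $\mathbb{R}^3$ with the Lorentz metric $\langle x,y\rangle=-x_1y_1+x_2y_2+x_3y_3$. A vector $\vec v$ is spacelike if $\langle\vec v,\vec v\rangle>0$ or $\vec v=0$, timelike if $\langle\vec v,\vec v\rangle<0$, null if $\langle\vec v,\vec v\rangle=0$ and $\vec v\ne0$; a curve has the causal character of its velocity vectors. A ruled surface is parametrized with its striction curve as base curve, $\vec c(s)+v\,\vec q(s)$, where $s$ is arc length of $\vec c$, $\langle\vec q,\vec q\rangle=\pm1$, $\langle d\vec c,d\vec q\rangle=0$, $\langle d\vec q,d\vec q\rangle\neq0$. The central normal $\vec h$ is the unit surface normal along the striction curve (in the direction $\pm d\vec q$). The surface is timelike if $\vec h$ is spacelike: of type $N_-$ if $\vec q$ is timelike, of type $N_+$ if $\vec q$ is spacelike. The surface is developable if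 its distribution parameter $\dfrac{\det(d\vec c,\vec q,d\vec q)}{\langle d\vec q,d\vec q\rangle}$ vanishes identically. Definition (similar ruled surfaces): two regular timelike ruled surfaces $N_\alpha,N_\beta$ of the same type, parametrized as in the claim, are called timelike similar ruled surfaces with variable transformation $\lambda_\beta^\alpha$ if there exists a variable transformation $s_\alpha=\int\lambda_\beta^\alpha(s_\beta)\,ds_\beta$ of the arc lengths such that $\vec q_\alpha(s_\alpha)=\vec q_\beta(s_\beta)$ for all corresponding values of the parameters under the transformation. Definition (similar curves): two regular curves parametrized by arc lengths $s_\alpha,s_\beta$ with unit tangents $\vec T_\alpha,\vec T_\beta$ are called similar curves with variable transformation $\lambda_\beta^\alpha$ if there exists a variable transformation $s_\alpha=\int\lambda_\beta^\alpha(s_\beta)\,ds_\beta$ of the arc lengths such that $\vec T_\alpha(s_\alpha)=\vec T_\beta(s_\beta)$ for all corresponding values of the parameters.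
   Formalization: Added hypothesis: the unit tangents of the two striction curves lie on the same side of their rulings (⟨T,q⟩ has the same sign on both surfaces); without it the claim fails, e.g. for equal timelike rulings q with α' = q and β' = −q. *)

(* Defs.v *)
From HB Require Import structures.
From mathcomp Require Import all_boot all_order all_algebra.
From mathcomp Require Import all_classical all_reals all_analysis.

Set Implicit Arguments.
Unset Strict Implicit.
Unset Printing Implicit Defensive.

Import Order.TTheory GRing.Theory Num.Theory.
Import numFieldNormedType.Exports.

Local Open Scope classical_set_scope.
Local Open Scope ring_scope.

Section Minkowski.
Variable R : realType.
Implicit Types (x y z : 'rV[R]_3).

Definition lorentz x y : R :=
  - (x 0 0 * y 0 0) + x 0 1 * y 0 1 + x 0 2 * y 0 2.

Definition spacelike x : Prop := 0 < lorentz x x \/ x = 0.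
Definition timelike x : Prop := lorentz x x < 0.
Definition null x : Prop := lorentz x x = 0 /\ x <> 0.

Definition same_causal_character x y : Prop :=
  [/\ spacelike x <-> spacelike y, timelike x <-> timelike y
    & null x <-> null y].

Definition det3 x y z : R :=
  \det (\matrix_(i < 3) tnth [tuple x; y; z] i).

End Minkowski.

Section RuledSurfaces.
Variable R : realType.
Implicit Types (I J : set R) (c d q : R -> 'rV[R]_3) (lambda phi : R -> R).

Definition open_interval I : Prop := [/\ I !=set0, open I & is_interval I].

Definition C1_on I c : Prop :=
  forall s, I s -> derivable c s 1 /\ {for s, continuous (derive1 c)}.

(* Arc length presupposes a non-null curve; both signs of <c', c'> are
   allowed. *)
Definition arc_length_parametrized I c : Prop :=
  forall s, I s -> `|lorentz (derive1 c s) (derive1 c s)| = 1.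

(* In [ruled_map] below, s ranges over [dom] and v over R. *)
Record ruled_surface := RuledSurface {
  dom : set R;
  base : R -> 'rV[R]_3;
  ruling : R -> 'rV[R]_3 }.

Implicit Types N : ruled_surface.

Definition ruled_map N (s v : R) : 'rV[R]_3 := base N s + v *: ruling N s.

(* The base curve is the striction curve, parametrized by arc length, and the
   ruling is normalized.  Immersivity of [ruled_map] is deliberately not
   required: on a developable surface it always fails along the striction
   curve (v = 0). Regularity is the non-degeneracy of the ruling's
   derivative. *)
Definition regular_ruled_surface N : Prop :=
  [/\ open_interval (dom N),
      C1_on (dom N) (base N),
      C1_on (dom N) (ruling N),
      arc_length_parametrized (dom N) (base N) &
      forall s, dom N s ->
        [/\ `|lorentz (ruling N s) (ruling N s)| = 1,
            lorentz (derive1 (base N) s) (derive1 (ruling N) s) = 0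
          & lorentz (derive1 (ruling N) s) (derive1 (ruling N) s) != 0]].

Definition central_normal N (s : R) : 'rV[R]_3 :=
  let dq := derive1 (ruling N) s in (Num.sqrt `|lorentz dq dq|)^-1 *: dq.

Definition type_Nminus N : Prop :=
  forall s, dom N s -> spacelike (central_normal N s) /\ timelike (ruling N s).

Definition type_Nplus N : Prop :=
  forall s, dom N s -> spacelike (central_normal N s) /\ spacelike (ruling N s).

Definition timelike_same_type N1 N2 : Prop :=
  (type_Nminus N1 /\ type_Nminus N2) \/ (type_Nplus N1 /\ type_Nplus N2).

Definition distribution_parameter N (s : R) : R :=
  let dq := derive1 (ruling N) s in
  det3 (derive1 (base N) s) (ruling N s) dq / lorentz dq dq.

Definition developable N : Prop :=
  forall s, dom N s -> distribution_parameter N s = 0.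

Definition striction_causal_as_ruling N : Prop :=
  forall s, dom N s ->
    same_causal_character (derive1 (base N) s) (ruling N s).

(* Arc length and unit ruling are only defined up to a sign.  The two surfaces
   are coherently oriented when the striction tangent lies on the same side of
   the ruling on both; this holds in particular under the usual normalization
   T = cosh(theta) q + sinh(theta) a on each surface.  Similarity of oriented
   tangents and of oriented rulings are unrelated without such a choice. *)
Definition coherently_oriented N1 N2 : Prop :=
  forall s t, dom N1 s -> dom N2 t ->
    0 < lorentz (derive1 (base N1) s) (ruling N1 s) *
        lorentz (derive1 (base N2) t) (ruling N2 t).

(* [phi] is a change of parameter from J onto I and an antiderivative of
   [lambda] on J, i.e. s_I = phi s_J = \int lambda(s_J) ds_J. *)
Definition variable_transformation J I lambda phi : Prop :=
  set_bij J I phi /\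
  forall s, J s ->
    [/\ is_derive s 1 phi (lambda s), {for s, continuous lambda}
      & lambda s != 0].

Definition similar_ruled_surfaces N1 N2 lambda : Prop :=
  exists phi, variable_transformation (dom N2) (dom N1) lambda phi /\
    forall s, dom N2 s -> ruling N1 (phi s) = ruling N2 s.

(* For curves parametrized by arc length, so that the derivatives are the unit
   tangents. *)
Definition similar_curves I c J d lambda : Prop :=
  exists phi, variable_transformation J I lambda phi /\
    forall s, J s -> derive1 c (phi s) = derive1 d s.

End RuledSurfaces.

(* Main.v *)
Require Import Defs.
From mathcomp Require Import all_boot all_order all_algebra.
From mathcomp Require Import all_classical all_reals all_analysis.
From mathcomp Require Import ring lra.

(** On a developable surface the striction tangent T is a multiple of the
    ruling q.  Indeed q has constant norm, so both T and q are orthogonal to the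
    derivative q', which is non-null; the vanishing of the distribution
    parameter makes T, q, q' linearly dependent, and pairing a dependence
    relation with q' removes its q'-term.  As T and q both have norm 1 up to
    sign, the factor is 1 or -1 ([striction_tangent_parallel_ruling]).

    Rulings of the two surfaces have the same norm because the surfaces are of
    the same type, so coherent orientation says exactly that the two factors
    have the same sign, hence are equal ([common_tangent_factor]).  Two tangents
    therefore agree if and only if the two rulings do, and a change of parameter
    realizes one similarity if and only if it realizes the other. *)

Import Order.TTheory GRing.Theory Num.Theory.
Import numFieldNormedType.Exports.
Local Open Scope classical_set_scope.
Local Open Scope ring_scope.

Section LorentzForm.
Variable R : realType.
Implicit Types (x y z : 'rV[R]_3) (q : R -> 'rV[R]_3).

Lemma lorentzC x y : lorentz x y = lorentz y x.
Proof. rewrite /lorentz; ring. Qed.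

Lemma lorentzDl x y z : lorentz (x + y) z = lorentz x z + lorentz y z.
Proof. rewrite /lorentz !mxE; ring. Qed.

Lemma lorentzZl (a : R) x y : lorentz (a *: x) y = a * lorentz x y.
Proof. rewrite /lorentz !mxE; ring. Qed.

Lemma lorentz0l x : lorentz 0 x = 0.
Proof. by rewrite -(scale0r 0) lorentzZl mul0r. Qed.

Lemma derive1_coord q (s : R) (i : 'I_3) : derivable q s 1 ->
  is_derive s 1 (fun t => q t 0 i) (derive1 q s 0 i).
Proof.
move=> dq; apply: DeriveDef; first by have /derivable_mxP := dq; apply.
by rewrite derive1E (derive_mx dq) mxE.
Qed.

Lemma is_derive_lorentz_sq q (s : R) : derivable q s 1 ->
  is_derive s 1 (fun t => lorentz (q t) (q t))
    (2 * lorentz (q s) (derive1 q s)).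
Proof.
move=> dq.
have d0 := derive1_coord q s 0 dq.
have d1 := derive1_coord q s 1 dq.
have d2 := derive1_coord q s 2 dq.
rewrite /lorentz.
apply: is_derive_eq.
rewrite /GRing.scale /=; ring.
Qed.

Lemma lorentz_constant_orthogonal (I : set R) q (e s : R) :
  open I -> I s -> derivable q s 1 ->
  (forall t, I t -> lorentz (q t) (q t) = e) ->
  lorentz (q s) (derive1 q s) = 0.
Proof.
move=> oI Is dq qe.
have E : 'D_1 (fun t => lorentz (q t) (q t)) s = 'D_1 (cst e) s.
  apply: near_eq_derive.
  by apply: filterS (open_nbhs_nbhs (conj oI Is)) => t /qe.
have := @derive_val _ _ _ _ _ _ _ (is_derive_lorentz_sq q s dq).
by rewrite E derive_cst => ?; lra.
Qed.

Lemma det3_eq0_dependent x y z : det3 x y z = 0 ->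
  exists a b c : R, [|| a != 0, b != 0 | c != 0] /\
    a *: x + b *: y + c *: z = 0.
Proof.
move=> /eqP/det0P[u u0 uM]; exists (u 0 0), (u 0 1), (u 0 2); split.
  apply: contraNT u0; rewrite !negb_or !negbK => /and3P[/eqP h0 /eqP h1 /eqP h2].
  apply/eqP/rowP => i; rewrite mxE.
  by case: i => [[|[|[|//]]] p]; [rewrite -[RHS]h0|rewrite -[RHS]h1|rewrite -[RHS]h2];
    congr (u _ _); apply: val_inj.
apply/rowP => j; rewrite !mxE.
have := congr1 (fun v : 'rV_3 => v 0 j) uM.
rewrite !mxE !big_ord_recl big_ord0 !mxE addr0 addrA !(tnth_nth 0) /= => <-.
by congr (u _ _ * _ + u _ _ * _ + u _ _ * _); apply: val_inj.
Qed.

(** Pairing a dependence relation with [z], which is orthogonal to [x] and [y]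
    but not null, kills the coefficient of [z]. *)
Lemma det3_eq0_orthogonal_parallel x y z :
  lorentz y y != 0 -> lorentz z z != 0 ->
  lorentz x z = 0 -> lorentz y z = 0 -> det3 x y z = 0 ->
  exists a : R, x = a *: y.
Proof.
move=> yy zz xz yz /det3_eq0_dependent[a [b [c [abc rel]]]].
have c0 : c = 0.
  have := congr1 (fun v => lorentz v z) rel.
  rewrite /= !lorentzDl !lorentzZl lorentz0l xz yz !mulr0 !add0r => /eqP.
  by rewrite mulf_eq0 (negbTE zz) orbF => /eqP.
move: abc rel; rewrite {}c0 scale0r addr0 eqxx orbF => ab rel.
have a0 : a != 0.
  apply/eqP => a0; move: ab rel; rewrite a0 eqxx scale0r add0r /= => b0 by0.
  have := congr1 (fun v => lorentz v y) by0.
  rewrite /= lorentzZl lorentz0l => /eqP.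
  by rewrite mulf_eq0 (negbTE b0) (negbTE yy).
exists (- (a^-1 * b)).
rewrite scaleNr -scalerA; apply/eqP; rewrite -addr_eq0.
by rewrite -[X in X + _](scale1r x) -(mulVf a0) -scalerA -scalerDr rel scaler0.
Qed.

End LorentzForm.

Section DevelopableSurfaces.
Variable R : realType.
Implicit Types N : ruled_surface R.

Lemma spacelike_unit (x : 'rV[R]_3) :
  spacelike x -> `|lorentz x x| = 1 -> lorentz x x = 1.
Proof.
case=> [xx|->]; first by rewrite gtr0_norm.
by rewrite lorentz0l normr0 => /eqP; rewrite eq_sym oner_eq0.
Qed.

Lemma timelike_unit (x : 'rV[R]_3) :
  timelike x -> `|lorentz x x| = 1 -> lorentz x x = -1.
Proof. by move=> xx; rewrite ltr0_norm// => <-; rewrite opprK. Qed.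

(** The type of a surface is the sign of the norm of its rulings. *)
Lemma same_type_ruling_norm N1 N2 :
  regular_ruled_surface N1 -> regular_ruled_surface N2 ->
  timelike_same_type N1 N2 ->
  exists2 e : R, e ^+ 2 = 1 &
    (forall s, dom N1 s -> lorentz (ruling N1 s) (ruling N1 s) = e) /\
    (forall s, dom N2 s -> lorentz (ruling N2 s) (ruling N2 s) = e).
Proof.
move=> [_ _ _ _ r1] [_ _ _ _ r2] [] [t1 t2].
- exists (-1); first by rewrite sqrrN expr1n.
  split=> s Ns.
  + by have [n1 _ _] := r1 _ Ns; have [_ ?] := t1 _ Ns; apply: timelike_unit.
  + by have [n1 _ _] := r2 _ Ns; have [_ ?] := t2 _ Ns; apply: timelike_unit.
- exists 1; first by rewrite expr1n.
  split=> s Ns.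
  + by have [n1 _ _] := r1 _ Ns; have [_ ?] := t1 _ Ns; apply: spacelike_unit.
  + by have [n1 _ _] := r2 _ Ns; have [_ ?] := t2 _ Ns; apply: spacelike_unit.
Qed.

Lemma striction_tangent_parallel_ruling N (e s : R) :
  regular_ruled_surface N -> developable N ->
  (forall t, dom N t -> lorentz (ruling N t) (ruling N t) = e) ->
  dom N s ->
  exists2 a : R, a ^+ 2 = 1 & derive1 (base N) s = a *: ruling N s.
Proof.
move=> [[_ oN _] _ C1q arc reg] dev qe Ns.
have [qq Tq' q'q'] := reg _ Ns.
have qq' := @lorentz_constant_orthogonal _ _ _ e _ oN Ns (C1q _ Ns).1 qe.
have det0 : det3 (derive1 (base N) s) (ruling N s) (derive1 (ruling N) s) = 0.
  have /eqP := dev _ Ns.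
  by rewrite /distribution_parameter mulf_eq0 invr_eq0 (negbTE q'q') orbF => /eqP.
have qq0 : lorentz (ruling N s) (ruling N s) != 0.
  by rewrite -normr_gt0 qq ltr01.
have [a Ta] := @det3_eq0_orthogonal_parallel _ _ _ _ qq0 q'q' Tq' qq' det0.
exists a => //.
have := arc _ Ns.
rewrite Ta lorentzZl lorentzC lorentzZl !normrM qq mulr1.
by rewrite -normrM -expr2 ger0_norm// sqr_ge0.
Qed.

(** The factors have square 1, so equal signs make them equal. *)
Lemma common_tangent_factor N1 N2 (s t : R) :
  regular_ruled_surface N1 -> regular_ruled_surface N2 ->
  timelike_same_type N1 N2 -> developable N1 -> developable N2 ->
  coherently_oriented N1 N2 -> dom N1 s -> dom N2 t ->
  exists2 a : R, a != 0 &
    derive1 (base N1) s = a *: ruling N1 s /\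
    derive1 (base N2) t = a *: ruling N2 t.
Proof.
move=> r1 r2 ty d1 d2 ori Ns Nt.
have [e e2 [q1 q2]] := @same_type_ruling_norm _ _ r1 r2 ty.
have [a a2 Ta] := @striction_tangent_parallel_ruling _ _ _ r1 d1 q1 Ns.
have [b b2 Tb] := @striction_tangent_parallel_ruling _ _ _ r2 d2 q2 Nt.
have ab_gt0 : 0 < a * b.
  have := ori _ _ Ns Nt.
  by rewrite Ta Tb !lorentzZl (q1 _ Ns) (q2 _ Nt) mulrACA -expr2 e2 mulr1.
have ab : b = a.
  move/eqP: b2; rewrite -a2 eqf_sqr => /orP[/eqP//|/eqP ba].
  by move: ab_gt0; rewrite ba mulrN oppr_gt0 -expr2 a2 ltr10.
exists a; first by rewrite -sqrf_eq0 a2 oner_eq0.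
by split; rewrite // Tb ab.
Qed.

End DevelopableSurfaces.

Theorem theorem4p4 (R : realType) (Na Nb : ruled_surface R)
  (regular_a : regular_ruled_surface Na)
  (regular_b : regular_ruled_surface Nb)
  (same_type : timelike_same_type Na Nb)
  (developable_a : developable Na)
  (developable_b : developable Nb)
  (causal_a : striction_causal_as_ruling Na)
  (causal_b : striction_causal_as_ruling Nb)
  (oriented : coherently_oriented Na Nb) :
  (exists lambda : R -> R, similar_ruled_surfaces Na Nb lambda) <->
  (exists lambda : R -> R,
     similar_curves (dom Na) (base Na) (dom Nb) (base Nb) lambda).
Proof.
have factor s t := @common_tangent_factor _ Na Nb s t regular_a regular_b
  same_type developable_a developable_b oriented.
split=> -[lambda [phi [vt eq_phi]]]; exists lambda, phi; split=> // s bs;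
  have as_ : dom Na (phi s) by [case: (vt) => -[+ _ _] _; apply].
- by have [c _ [-> ->]] := factor _ _ as_ bs; rewrite eq_phi.
- have [c c0 [Ta Tb]] := factor _ _ as_ bs.
  by apply: (scalerI c0); rewrite -Ta -Tb eq_phi.
Qed.
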